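(* Let $A=\{a_1,\dots,a_m\}\subseteq\mathbb{Z}^n$ be finite, $k\in\mathbb{N}$ and $f\in\mathbb{R}[t_1^{\pm1},\dots,t_n^{\pm1}]_{k\cdot A}$. The following are equivalent: (i) $f$ is strictly $A$-copositive; (ii) $\operatorname{Newt}(f)=\operatorname{conv}(k\cdot A)$ and there exists $M\in\mathbb{N}$ such that $\big(\sum_{i=1}^mt^{a_i}\big)^Mf$ has a strictly positive coefficient at $t^b$ for every $b\in(k+M)\cdot A$; (iii) $\operatorname{Newt}(f)=\operatorname{conv}(k\cdot A)$ and there exists $N\in\mathbb{N}$ such that $\big(\sum_{i=1}^mt^{a_i}\big)^Nf$ has only nonnegative coefficients.
   Context: $k\cdot A=\{\sum_jv_ja_j: v_j\in\mathbb{N},\sum_jv_j=k\}$; $\mathbb{R}[t^{\pm1}]_S$ is the space of Laurent polynomials with support in $S$; $\operatorname{Newt}(f)$ is the convex hull of the support of $f$. Let $Y_{\hat A}\subseteq\mathbb{C}^m$ be the Zariski closure of the image of $(\mathbb{C}^* )^{n+1}\to\mathbb{C}^m$, $(u,t)\mapsto(ut^{a_1},\dots,ut^{a_m})$, and $(Y_{\hat A})_{\ge0}=Y_{\hat A}\cap\mathbb{R}^m_{\ge0}$. For $f=\sum_{b\in k\cdot A}c_bt^b$ choose $v_{jb}\in\mathbb{N}$ with $\sum_jv_{jb}=k$, $b=\sum_jv_{jb}a_j$ and put $\hat f(y)=\sum_bc_b\prod_jy_j^{v_{jb}}$ (its values on $Y_{\hat A}$ do not depend on the choices). $f$ is strictly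 $A$-copositive if $\hat f>0$ on $(Y_{\hat A})_{\ge0}\setminus\{0\}$; equivalently, $f$ lies in the interior of the cone of elements of $\mathbb{R}[t^{\pm1}]_{k\cdot A}$ nonnegative on $\mathbb{R}^n_{>0}$. *)

(* Defs.v *)
From HB Require Import structures.
From mathcomp Require Import all_boot all_order all_algebra.
From Stdlib Require Import Rdefinitions.
From mathcomp Require Import Rstruct.
From mathcomp Require Import complex.
From mathcomp Require Import mpoly.

Set Implicit Arguments.
Unset Strict Implicit.
Unset Printing Implicit Defensive.

Import Order.TTheory GRing.Theory Num.Theory.
Local Open Scope ring_scope.

Section Copositivity.

Variables (n m : nat) (a : 'I_m -> 'rV[int]_n).

Definition sumA (k : nat) (s : k.-tuple 'I_m) : 'rV[int]_n :=
  \sum_(j < k) a (tnth s j).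

Definition in_kA (k : nat) (b : 'rV[int]_n) : bool :=
  [exists s : k.-tuple 'I_m, sumA s == b].

Definition kA (k : nat) : seq 'rV[int]_n :=
  undup [seq sumA s | s : k.-tuple 'I_m].

(* Laurent polynomials in R[t^{+-1}] are represented by their coefficient
   functions f : Z^n -> R (coefficient of t^b is f b);
   f lies in R[t^{+-1}]_S iff its support is contained in S. *)
Definition supported_in (k : nat) (f : 'rV[int]_n -> R) : Prop :=
  forall b, f b != 0 -> in_kA k b.

Definition in_conv (s : seq 'rV[int]_n) (x : 'I_n -> R) : Prop :=
  exists l : 'I_(size s) -> R,
    [/\ forall i, 0 <= l i, \sum_(i < size s) l i = 1 &
        forall p, x p = \sum_(i < size s) l i * ((nth 0 s i) 0 p)%:~R].

Definition support (k : nat) (f : 'rV[int]_n -> R) : seq 'rV[int]_n :=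
  [seq b <- kA k | f b != 0].

Definition newt_eq_conv_kA (k : nat) (f : 'rV[int]_n -> R) : Prop :=
  forall x, in_conv (support k f) x <-> in_conv (kA k) x.

(* multiplication by the Laurent polynomial sum_i t^{a_i}:
   coefficient of t^b in (sum_i t^{a_i}) g is sum_i g_{b - a_i} *)
Definition mulA (g : 'rV[int]_n -> R) : 'rV[int]_n -> R :=
  fun b => \sum_(i < m) g (b - a i).

Definition mulA_pow (N : nat) (f : 'rV[int]_n -> R) : 'rV[int]_n -> R :=
  iter N mulA f.

Local Notation C := (R[i]).

Definition torus_pt (u : C) (t : 'I_n -> C) : 'I_m -> C :=
  fun j => u * \prod_(l < n) t l ^ (a j 0 l).

(* Y_{\hat A} = Zariski closure of the image of that map in C^m:
   common zero set of all polynomials vanishing on the image. *)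
Definition in_Y (y : 'I_m -> C) : Prop :=
  forall p : {mpoly C[m]},
    (forall (u : C) (t : 'I_n -> C), u != 0 -> (forall l, t l != 0) ->
        p.@[torus_pt u t] = 0) ->
    p.@[y] = 0.

(* \hat f evaluated at y, for a choice w b = (s_1,...,s_k) with
   b = a_{s_1} + ... + a_{s_k}; the monomial prod_j y_{s_j} is
   prod_j y_j^{v_{jb}} where v_{jb} = #{i | s_i = j}. *)
Definition fhat (k : nat) (f : 'rV[int]_n -> R)
    (w : 'rV[int]_n -> k.-tuple 'I_m) (y : 'I_m -> R) : R :=
  \sum_(b <- kA k) f b * \prod_(j < k) y (tnth (w b) j).

Definition strictly_A_copositive (k : nat) (f : 'rV[int]_n -> R) : Prop :=
  forall y : 'I_m -> R,
    (forall j, 0 <= y j) -> (exists j, y j != 0) ->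
    in_Y (fun j => (y j)%:C%C) ->
    forall w : 'rV[int]_n -> k.-tuple 'I_m,
      (forall b, in_kA k b -> sumA (w b) = b) ->
      0 < fhat f w y.

End Copositivity.

(* Main.v *)
Require Import Defs.
From HB Require Import structures.
From mathcomp Require Import all_boot all_order all_algebra.
From Stdlib Require Import Rdefinitions.
From mathcomp Require Import Rstruct.
From mathcomp Require Import complex.
From mathcomp Require Import mpoly.
From mathcomp Require Import ring lra zify.
From mathcomp Require boolp classical_sets set_interval reals topology normedtype.
Import Order.TTheory GRing.Theory Num.Theory.
Local Open Scope ring_scope.

Set Implicit Arguments.
Unset Strict Implicit.
Unset Printing Implicit Defensive.

(** A point y >= 0 lies on Y exactly when it satisfies all the binomial equations y^w = y^w'
    between words w, w' in the index set of equal length and equal weight (the weight of w is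
    the sum of the a_i over the letters of w).  If f is strictly copositive then the compactness
    of the standard simplex gives finitely many squares of such binomials and a constant D such
    that fhat + D * (sum of squares) is positive on the whole simplex.  Made homogeneous by
    powers of sum_i y_i, this form maps to a power of sum_i t^(a_i) times f, because the squares
    map to 0; so Polya's theorem in the variables y yields (ii).

    Conversely, if (sum_i t^(a_i))^N f has nonnegative coefficients, then (sum_i y_i)^N fhat(y)
    is a sum of nonnegative terms at y in Y.  The index v of maximal norm |a_v| among the nonzero
    coordinates of y is a vertex of A, and the term at (k + N) a_v is f(k a_v) y_v^(k+N) > 0.
    Throughout, a vertex is an index v such that only the constant word has weight L a_v and
    length L; Gordan's theorem relates this to the condition on the Newton polytope. *)

(** * Forms as lists of terms indexed by words *)

Definition mon (K : pzRingType) (m : nat) (x : 'I_m -> K) (w : seq 'I_m) : K :=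
  \prod_(i <- w) x i.

(** A form is an unnormalized list of terms whose monomials are words in the variables: addition is
    concatenation of lists, and degree is word length. *)
Definition form_eval (K : pzRingType) (m : nat) (T : seq (K * seq 'I_m))
  (x : 'I_m -> K) : K := \sum_(t <- T) t.1 * mon x t.2.

Definition in_simplex (K : numDomainType) (m : nat) (x : 'I_m -> K) : Prop :=
  (forall i, 0 <= x i) /\ \sum_i x i = 1.

Lemma simplex_le1 (K : numDomainType) (m : nat) (x : 'I_m -> K) i :
  in_simplex x -> x i <= 1.
Proof. by move=> [x0 <-]; rewrite (bigD1 i) //= lerDl sumr_ge0. Qed.

Lemma mon_ge0 (K : numDomainType) (m : nat) (x : 'I_m -> K) w :
  (forall i, 0 <= x i) -> 0 <= mon x w.
Proof. by move=> x0; apply: prodr_ge0. Qed.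

Lemma form_eval_simplex_ge (K : realDomainType) (m : nat)
    (T : seq (K * seq 'I_m)) (x : 'I_m -> K) :
  in_simplex x -> - \sum_(t <- T) `|t.1| <= form_eval T x.
Proof.
move=> xS; rewrite lerNl -sumrN; apply: ler_sum => t _.
have m0 : 0 <= mon x t.2 by apply: mon_ge0; case: xS.
have m1 : mon x t.2 <= 1.
  by apply: prodr_ile1 => i _; rewrite simplex_le1 // andbT; case: xS.
rewrite -mulNr; apply: le_trans (ler_norm _) _.
by rewrite normrM normrN (ger0_norm m0) ler_piMr.
Qed.

(** * Compactness of the simplex *)

Module Compactness.
Import boolp classical_sets set_interval reals topology normedtype.
Import numFieldNormedType.Exports.
Local Open Scope classical_set_scope.

Section Compactness.
Variable R : realType.

Lemma continuous_sum_seq (V : topologicalType) (I : Type) (s : seq I)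
    (g : I -> V -> R) : (forall i, continuous (g i)) ->
  continuous (fun v => \sum_(i <- s) g i v).
Proof.
move=> cg; elim: s => [|i s IHs] v.
  under eq_fun do rewrite big_nil.
  exact: cvg_cst.
under eq_fun do rewrite big_cons.
exact: (continuousD (cg i v) (IHs v)).
Qed.

Lemma continuous_prod_seq (V : topologicalType) (I : Type) (s : seq I)
    (g : I -> V -> R) : (forall i, continuous (g i)) ->
  continuous (fun v => \prod_(i <- s) g i v).
Proof.
move=> cg; elim: s => [|i s IHs] v.
  under eq_fun do rewrite big_nil.
  exact: cvg_cst.
under eq_fun do rewrite big_cons.
exact: (continuousM (cg i v) (IHs v)).
Qed.

Lemma continuous_form_eval (m : nat) (T : seq (R * seq 'I_m)) :
  continuous (fun v : 'rV[R]_m => form_eval T (v 0)).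
Proof.
apply: continuous_sum_seq => t v /=.
apply: continuousM; first exact: cst_continuous.
by apply: continuous_prod_seq => i; exact: coord_continuous.
Qed.

Lemma compact_simplex (m : nat) :
  compact [set v : 'rV[R]_m | in_simplex (v 0)].
Proof.
have cB : compact [set v : 'rV[R]_m | forall i, `[0 : R, 1]%classic (v ord0 i)].
  apply: (@rV_compact _ _ (fun=> `[0 : R, 1]%classic)).
  by move=> i; exact: segment_compact.
apply: (subclosed_compact _ cB _).
- have -> : [set v : 'rV[R]_m | in_simplex (v 0)] =
    (\bigcap_(i in [set: 'I_m]) (fun v : 'rV[R]_m => v 0 i) @^-1` [set x | 0 <= x])
    `&` (fun v : 'rV[R]_m => \sum_i v 0 i) @^-1` [set 1].
    by apply/seteqP; split=> v /= [p0 p1]; split=> //= i; [move=> _|]; exact: p0.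
  apply: closedI.
    apply: closed_bigI => i _; apply: preimage_closed; last exact: closed_ge.
    by move=> v _; exact: coord_continuous.
  apply: preimage_closed; last exact: closed_eq.
  by move=> v _; apply: continuous_sum_seq => i; exact: coord_continuous.
- move=> v /= [v0 v1] i; rewrite /= in_itv /= v0 /= -v1 (bigD1 i) //= lerDl.
  by apply: sumr_ge0 => j _; exact: v0.
Qed.

(** If every D fails, choose a bad point for each D. At a cluster point in the compact simplex all
    [G i] vanish and [T] is at most 0, a contradiction. *)
Lemma penalty_lower_bound (m : nat) (T : seq (R * seq 'I_m))
    (G : nat -> seq (R * seq 'I_m)) :
  (forall i x, in_simplex x -> 0 <= form_eval (G i) x) ->
  (forall x, in_simplex x -> (forall i, form_eval (G i) x = 0) ->
     0 < form_eval T x) ->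
  exists D : nat, forall x, in_simplex x ->
    D.+1%:R^-1 <= form_eval T x + D%:R * \sum_(i < D) form_eval (G i) x.
Proof.
move=> G0 Tpos; apply: contrapT => /forallNP noD.
have /choice[u uP] : forall D : nat, exists x, in_simplex x /\
    form_eval T x + D%:R * \sum_(i < D) form_eval (G i) x < D.+1%:R^-1.
  move=> D; have /existsNP[x /not_implyP[xS /negP]] := noD D.
  by rewrite -ltNge => xD; exists x.
pose v D : 'rV[R]_m := \row_i u D i.
have vE D : v D 0 = u D by apply/funext => i; rewrite mxE.
have [|p [pS pcl]] := @compact_simplex m (v @ \oo) _.
  by exists 0%N => // D _ /=; rewrite vE; case: (uP D).
have closedP (A : set 'rV[R]_m) : closed A -> (\forall D \near \oo, A (v D)) -> A p.
  by move=> clA nA; apply: clA => B nB; exact: pcl.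
have Tle : form_eval T (p 0) <= 0.
  apply/ler_addgt0Pr => e e0; rewrite add0r.
  apply: (closedP [set w : 'rV[R]_m | form_eval T (w 0) <= e]).
    apply: (@preimage_closed _ _ (fun w : 'rV[R]_m => form_eval T (w 0)) [set x | x <= e]).
      by move=> w _; exact: continuous_form_eval.
    exact: closed_le.
  near=> D; have [xS xD] := uP D.
  rewrite /= vE.
  have : form_eval T (u D) <= D.+1%:R^-1.
    apply: le_trans (ltW xD); rewrite lerDl mulr_ge0 // sumr_ge0 // => i _.
    exact: G0.
  have eD : e^-1 <= D%:R by near: D; exact: nbhs_infty_ger.
  move=> /le_trans; apply; rewrite invf_ple ?posrE ?ltr0n //.
  by apply: le_trans eD _; rewrite ler_nat.
(* [T] is at least -B on the simplex, so once D exceeds i the value of [G i] at [u D] is at most (1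
   + B) / D. *)
have Gle i : form_eval (G i) (p 0) <= 0.
  pose B := \sum_(t <- T) `|t.1|.
  have B0 : 0 <= B by apply: sumr_ge0.
  apply/ler_addgt0Pr => e e0; rewrite add0r.
  apply: (closedP [set w : 'rV[R]_m | form_eval (G i) (w 0) <= e]).
    apply: (@preimage_closed _ _ (fun w : 'rV[R]_m => form_eval (G i) (w 0)) [set x | x <= e]).
      by move=> w _; exact: continuous_form_eval.
    exact: closed_le.
  near=> D; have [xS xD] := uP D.
  have iD : (i < D)%nat by near: D; exact: nbhs_infty_gt.
  have D0 : (0 : R) < D%:R by rewrite ltr0n (leq_ltn_trans _ iD).
  have BD : (1 + B) / e <= D%:R by near: D; exact: nbhs_infty_ger.
  rewrite /= vE -(ler_pM2l D0).
  have : D%:R * form_eval (G i) (u D) <= 1 + B.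
    have T0 := form_eval_simplex_ge T xS.
    have s0 : form_eval (G i) (u D) <= \sum_(i < D) form_eval (G i) (u D).
      by rewrite (bigD1 (Ordinal iD)) //= lerDl sumr_ge0 // => j _; exact: G0.
    have := ler_wpM2l (ltW D0) s0; move: xD T0; rewrite -/B.
    have : (D.+1%:R^-1 : R) <= 1 by rewrite invf_le1 ?ler1n ?ltr0n.
    set X := \sum_(i < D) _; set Y := D.+1%:R^-1; set Z := form_eval T _.
    set V := D%:R * X; set W := D%:R * _.
    by move=> *; lra.
  by move=> /le_trans; apply; rewrite -ler_pdivrMr.
have G00 i : form_eval (G i) (p 0) = 0 by apply/eqP; rewrite eq_le Gle G0.
by have := Tpos _ pS G00; rewrite ltNge Tle.
Unshelve. all: by end_near.
Qed.
End Compactness.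
End Compactness.

(** * Sums over words *)

Definition wt (n m : nat) (a : 'I_m -> 'rV[int]_n) (w : seq 'I_m) : 'rV[int]_n :=
  \sum_(i <- w) a i.

Lemma wt_cons n m (a : 'I_m -> 'rV[int]_n) i w : wt a (i :: w) = a i + wt a w.
Proof. by rewrite /wt big_cons. Qed.

Lemma wt_cat n m (a : 'I_m -> 'rV[int]_n) w w' : wt a (w ++ w') = wt a w + wt a w'.
Proof. by rewrite /wt big_cat. Qed.

Lemma wt_nseq n m (a : 'I_m -> 'rV[int]_n) k i : wt a (nseq k i) = a i *+ k.
Proof.
elim: k => [|k IHk]; first by rewrite /wt big_nil mulr0n.
by rewrite wt_cons IHk mulrS.
Qed.

Lemma mon_cat (K : pzRingType) m (x : 'I_m -> K) w w' :
  mon x (w ++ w') = mon x w * mon x w'.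
Proof. by rewrite /mon big_cat. Qed.

Lemma mon_cons (K : pzRingType) m (x : 'I_m -> K) i w :
  mon x (i :: w) = x i * mon x w.
Proof. by rewrite /mon big_cons. Qed.

Lemma mon_nseq (K : pzRingType) m (x : 'I_m -> K) k i : mon x (nseq k i) = x i ^+ k.
Proof.
elim: k => [|k IHk]; first by rewrite /mon big_nil expr0.
by rewrite mon_cons IHk exprS.
Qed.

Lemma mon_le_exp (K : numDomainType) m (x : 'I_m -> K) (L : K) w :
  (forall i, 0 <= x i <= L) -> mon x w <= L ^+ size w.
Proof.
move=> xL; elim: w => [|i w IHw]; first by rewrite /mon big_nil expr0.
have x0 j : 0 <= x j by case/andP: (xL j).
by rewrite mon_cons exprS ler_pM ?mon_ge0 //; case/andP: (xL i).
Qed.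

Lemma sumAE n m (a : 'I_m -> 'rV[int]_n) k (s : k.-tuple 'I_m) : sumA a s = wt a s.
Proof. by rewrite /sumA /wt big_tuple. Qed.

Lemma in_kAP n m (a : 'I_m -> 'rV[int]_n) k b :
  reflect (exists2 w, size w = k & wt a w = b) (in_kA a k b).
Proof.
apply: (iffP existsP) => [[s /eqP sb]|[w wk wb]].
  by exists s; rewrite ?size_tuple // -sumAE.
by exists (tcast wk (in_tuple w)); rewrite sumAE val_tcast wb.
Qed.

Lemma mem_kA n m (a : 'I_m -> 'rV[int]_n) k b : (b \in kA a k) = in_kA a k b.
Proof.
rewrite mem_undup; apply/mapP/existsP => [[s _ ->]|[s /eqP <-]]; first by exists s.
by exists s; rewrite ?mem_enum.
Qed.

Section WordSums.
Variables (K : comPzRingType) (m : nat).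
Implicit Types (phi psi : seq 'I_m -> K) (u w : seq 'I_m).

Fixpoint sum_words (L : nat) (phi : seq 'I_m -> K) : K :=
  if L is L'.+1 then \sum_j sum_words L' (fun u => phi (j :: u)) else phi [::].

Lemma sum_wordsS L phi :
  sum_words L.+1 phi = \sum_j sum_words L (fun u => phi (j :: u)).
Proof. by []. Qed.

Lemma eq_sum_words L phi psi : (forall u, size u = L -> phi u = psi u) ->
  sum_words L phi = sum_words L psi.
Proof.
elim: L phi psi => [|L IHL] phi psi eqf /=; first exact: eqf.
by apply: eq_bigr => j _; apply: IHL => u uL; apply: eqf; rewrite /= uL.
Qed.

Lemma sum_words_sum (I : Type) (T : seq I) L (phi : I -> seq 'I_m -> K) :
  sum_words L (fun u => \sum_(t <- T) phi t u) = \sum_(t <- T) sum_words L (phi t).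
Proof.
elim: L phi => [|L IHL] phi //=; rewrite exchange_big /=.
by apply: eq_bigr => j _; rewrite IHL.
Qed.

Lemma sum_wordsZ L c phi :
  sum_words L (fun u => c * phi u) = c * sum_words L phi.
Proof.
elim: L phi => [|L IHL] phi //=; rewrite mulr_sumr.
by apply: eq_bigr => j _; rewrite IHL.
Qed.

Lemma sum_words_mon L (x : 'I_m -> K) :
  sum_words L (mon x) = (\sum_i x i) ^+ L.
Proof.
elim: L => [|L IHL] /=; first by rewrite /mon big_nil.
rewrite exprS mulr_suml; apply: eq_bigr => j _.
rewrite -IHL -sum_wordsZ; apply: eq_sum_words => u _; exact: mon_cons.
Qed.

Definition symmetric_fun phi := forall u v, perm_eq u v -> phi u = phi v.

Lemma symmetric_fun_cons phi i :
  symmetric_fun phi -> symmetric_fun (fun u => phi (i :: u)).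
Proof. by move=> symf u v uv; apply: symf; rewrite perm_cons. Qed.

(* Double counting of the pairs (word, position carrying the letter i). *)
Lemma sum_words_count L i phi : symmetric_fun phi ->
  sum_words L.+1 (fun u => (count_mem i u)%:R * phi u) =
  L.+1%:R * sum_words L (fun u => phi (i :: u)).
Proof.
elim: L phi => [|L IHL] phi symf.
  rewrite /= (bigD1 i) //= eqxx big1 ?addr0 ?mul1r // => j ji.
  by rewrite (negbTE ji) mul0r.
have -> : sum_words L.+2 (fun u => (count_mem i u)%:R * phi u) =
    \sum_j (sum_words L.+1 (fun u => (j == i)%:R * phi (j :: u)) +
            sum_words L.+1 (fun u => (count_mem i u)%:R * phi (j :: u))).
  rewrite sum_wordsS; apply: eq_bigr => j _.
  (* Additivity for two summands is taken from a two-element index list: [true] for the first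
     letter, [false] for the tail. *)
  have := @sum_words_sum bool [:: true; false] L.+1
    (fun t u => (if t then (j == i) : nat else count_mem i u)%:R * phi (j :: u)).
  rewrite !big_cons big_nil addr0 => <-; apply: eq_sum_words => u _.
  by rewrite !big_cons big_nil addr0 -mulrDl -natrD.
rewrite big_split mulrS mulrDl mul1r; congr (_ + _).
  rewrite (bigD1 i) // big1 ?Monoid.mulm1 => [|j ji].
    by apply: eq_sum_words => u _; rewrite eqxx mul1r.
  by rewrite (sum_wordsZ L.+1 _ (fun u => phi (j :: u))) (negbTE ji) mul0r.
rewrite sum_wordsS mulr_sumr; apply: eq_bigr => j _.
have -> := IHL (fun u => phi (j :: u)) (symmetric_fun_cons j symf).
congr (_ * _); apply: eq_sum_words => u _; apply: symf.
by rewrite -(cat1s j) -(cat1s i (j :: u)) -(cat1s i u) -(cat1s j u) perm_catCA.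
Qed.

(* The product over the letters i of the falling factorials of length
   count i w of the multiplicities count i u. *)
Fixpoint ff w u : K :=
  if w is i :: w' then (count_mem i u)%:R * ff w' (rem i u) else 1.

Lemma perm_rem i u v : perm_eq u v -> perm_eq (rem i u) (rem i v).
Proof.
by move=> uv; apply/permP => P; rewrite !count_rem (permP uv) (perm_mem uv).
Qed.

Lemma ff_sym w : symmetric_fun (ff w).
Proof.
elim: w => [|i w IHw] u v uv //=.
by rewrite (permP uv) (IHw _ _ (perm_rem i uv)).
Qed.

(** [ff w u] counts the placements of the letters of w at distinct positions of u, and by symmetry
    these positions may be moved to the front, one letter at a time. *)
Lemma sum_words_ff w M phi : symmetric_fun phi ->
  sum_words (size w + M) (fun u => ff w u * phi u) =
  ((size w + M) ^_ (size w))%:R * sum_words M (fun u => phi (w ++ u)).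
Proof.
elim: w phi => [|i w IHw] phi symf.
  by rewrite ffactn0 mul1r; apply: eq_sum_words => u _; rewrite /= mul1r.
rewrite ffactSS natrM -mulrA -(IHw _ (symmetric_fun_cons i symf)).
have -> : sum_words (size (i :: w) + M) (fun u => ff (i :: w) u * phi u) =
   sum_words (size w + M).+1
     (fun u => (count_mem i u)%:R * (ff w (rem i u) * phi u)).
  by apply: eq_sum_words => u _; rewrite mulrA.
rewrite sum_words_count => [|u v uv].
  by congr (_ * _); apply: eq_sum_words => u _; rewrite /= eqxx.
by rewrite (ff_sym w (perm_rem i uv)) (symf _ _ uv).
Qed.

End WordSums.

Lemma sum_words_gt0 (K : realDomainType) m L (phi : seq 'I_m -> K) u :
  (forall u, size u = L -> 0 <= phi u) -> size u = L -> 0 < phi u ->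
  0 < sum_words L phi.
Proof.
elim: L phi u => [|L IHL] phi u phi0; first by move=> /size0nil ->.
have ge0 (M : nat) psi : (forall u, size u = M -> 0 <= psi u) -> 0 <= sum_words M psi :> K.
  elim: M psi => [|M IHM] psi psi0 /=; first exact: psi0.
  by apply: sumr_ge0 => j _; apply: IHM => v vM; apply: psi0; rewrite /= vM.
case: u => [|i u] //= [uL] pos; rewrite (bigD1 i) //=.
apply: ltr_pwDl; first by apply: (IHL _ u) => // v vL; apply: phi0; rewrite /= vL.
by apply: sumr_ge0 => j _; apply: ge0 => v vL; apply: phi0; rewrite /= vL.
Qed.

(** Replacing powers by falling factorials costs one order of L. The slack r drives the induction:
    each letter removed from u adds one unit. The factor L avoids division. *)
Lemma ff_mon_bound (K : realDomainType) m (w u : seq 'I_m) (alpha : 'I_m -> K) (r L : K) :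
  0 <= r -> 0 <= L ->
  (forall i, (count_mem i u)%:R <= alpha i) ->
  (forall i, alpha i <= (count_mem i u)%:R + r) -> (forall i, alpha i <= L) ->
  0 <= mon alpha w - ff K w u /\
  L * (mon alpha w - ff K w u) <= (size w)%:R * (r + (size w)%:R) * L ^+ size w.
Proof.
move=> r0 L0 + + alphaL; elim: w u r r0 => [|i w IHw] u r r0 ge le.
  by rewrite /mon big_nil subrr mulr0 !mul0r.
rewrite mon_cons /=; set c : K := (count_mem i u)%:R.
have c0 : 0 <= c by rewrite ler0n.
have a0 j : 0 <= alpha j by apply: le_trans (ge j); rewrite ler0n.
have mon0 : 0 <= mon alpha w by apply: mon_ge0.
have monL : mon alpha w <= L ^+ size w.
  by apply: mon_le_exp => j; rewrite a0 alphaL.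
set F := ff K w _; set d : K := (size w)%:R; set P := L ^+ size w.
have d0 : 0 <= d by rewrite ler0n.
have P0 : 0 <= P by apply: exprn_ge0.
(* If i does not occur in u, then [ff] vanishes, but [alpha i] is at most r and the whole monomial
   is an error term. *)
have [ci|ci] := boolP (i \in u); last first.
  have -> : c = 0 by rewrite /c (count_memPn ci).
  have ar : alpha i <= r.
    by have := le i; rewrite (count_memPn ci) add0r.
  rewrite mul0r subr0; split; first exact: mulr_ge0.
  rewrite exprS -/P mulrCA; apply: le_trans (_ : r * (L * P) <= _).
    by rewrite ler_pM ?mulr_ge0 // ler_wpM2l.
  rewrite ler_wpM2r ?mulr_ge0 // -natr1 -/d.
  nra.
have [||F0 FL] := IHw (rem i u) (r + 1) (addr_ge0 r0 ler01).
- move=> j; apply: le_trans (ge j); rewrite ler_nat count_rem; exact: leq_subr.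
- move=> j; apply: le_trans (le j) _.
  rewrite [r + 1]addrC addrA lerD2r natr1 ler_nat count_rem.
  by case: (_ && _); rewrite ?subn0 ?subn1 ?leqSpred // leqnSn.
rewrite -/F in F0 FL.
have cL : c <= L by apply: le_trans (ge i) (alphaL i).
have cr : alpha i - c <= r by rewrite lerBlDl; exact: le.
have cr0 : 0 <= alpha i - c by rewrite subr_ge0; exact: ge.
have -> : alpha i * mon alpha w - c * F =
  (alpha i - c) * mon alpha w + c * (mon alpha w - F) by ring.
split; first by rewrite addr_ge0 // mulr_ge0.
rewrite exprS -/P -natr1 -/d mulrDr.
apply: le_trans (_ : r * (L * P) + L * (d * (r + 1 + d) * P) <= _).
  apply: lerD.
    by rewrite mulrCA ler_pM ?mulr_ge0 // ler_wpM2l.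
  by rewrite mulrCA ler_pM // ?mulr_ge0.
rewrite -subr_ge0.
have -> : (d + 1) * (r + (d + 1)) * (L * P) - (r * (L * P) + L * (d * (r + 1 + d) * P)) =
    (1 + d) * (L * P) by ring.
by rewrite !mulr_ge0 // addr_ge0.
Qed.

(** * Polya's theorem *)

Lemma monZ (K : comPzRingType) m (c : K) (x : 'I_m -> K) w :
  mon (fun i => c * x i) w = c ^+ size w * mon x w.
Proof.
elim: w => [|i w IHw]; first by rewrite /mon !big_nil mulr1.
by rewrite !mon_cons IHw exprS mulrACA.
Qed.

Lemma sum_count_mem m (u : seq 'I_m) : (\sum_(i < m) count_mem i u)%nat = size u.
Proof.
elim: u => [|j u IHu] /=; first by rewrite big1.
by rewrite big_split /= IHu (bigD1 j) //= eqxx big1 // => i; rewrite eq_sym => /negbTE ->.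
Qed.

Lemma mulA_powE n m (a : 'I_m -> 'rV[int]_n) M h b :
  mulA_pow a M h b = sum_words M (fun u => h (b - wt a u)).
Proof.
elim: M b => [|M IHM] b; first by rewrite /= /wt big_nil subr0.
rewrite /mulA_pow iterS -/(mulA_pow a M h) /mulA sum_wordsS.
apply: eq_bigr => i _; rewrite IHM; apply: eq_sum_words => u _.
by rewrite wt_cons opprD addrA.
Qed.

(** The image of the form under the substitution of t^(a_i) for y_i. *)
Definition form_coef n m (a : 'I_m -> 'rV[int]_n) (T : seq (R * seq 'I_m)) b : R :=
  \sum_(t <- T) t.1 * (wt a t.2 == b)%:R.

Definition homogeneous (K : Type) m (d : nat) (T : seq (K * seq 'I_m)) :=
  all (fun t => size t.2 == d) T.

Lemma mulA_pow_form n m (a : 'I_m -> 'rV[int]_n) M T b :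
  mulA_pow a M (form_coef a T) b =
  \sum_(t <- T) t.1 * sum_words M (fun u => (wt a (t.2 ++ u) == b)%:R).
Proof.
rewrite mulA_powE sum_words_sum; apply: eq_bigr => t _.
rewrite sum_wordsZ; congr (_ * _); apply: eq_sum_words => u _.
by rewrite wt_cat eq_sym subr_eq eq_sym.
Qed.

(** Scale the multiplicities of u into the simplex. With L the length of u, homogeneity gives a main
    term of at least e L^d, which beats the falling-factorial error of order L^(d-1). *)
Lemma sum_ff_gt0 m d (T : seq (R * seq 'I_m)) (e : R) (u : seq 'I_m) :
  homogeneous d T -> (0 < size u)%nat ->
  (forall x, in_simplex x -> e <= form_eval T x) ->
  (\sum_(t <- T) `|t.1|) * d%:R ^+ 2 < e * (size u)%:R ->
  0 < \sum_(t <- T) t.1 * ff R t.2 u.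
Proof.
move=> /allP homT u0 Te; set B := \sum_(t <- T) _; set L : R := (size u)%:R => Be.
have L0 : 0 < L by rewrite ltr0n.
pose alpha i : R := (count_mem i u)%:R.
have alphaL i : alpha i <= L by rewrite ler_nat count_size.
have xS : in_simplex (fun i => L^-1 * alpha i).
  split=> [i|]; first by rewrite mulr_ge0 ?invr_ge0 ?ler0n // ltW.
  by rewrite -mulr_sumr -natr_sum sum_count_mem mulVf // gt_eqF.
have evE : \sum_(t <- T) t.1 * mon alpha t.2 = L ^+ d * form_eval T (fun i => L^-1 * alpha i).
  rewrite mulr_sumr !big_seq; apply: eq_bigr => t /homT /eqP td.
  by rewrite monZ td mulrCA exprVn mulVKf // expf_neq0 // gt_eqF.
rewrite -(pmulr_rgt0 _ L0).
have -> : \sum_(t <- T) t.1 * ff R t.2 u =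
    \sum_(t <- T) t.1 * mon alpha t.2 - \sum_(t <- T) t.1 * (mon alpha t.2 - ff R t.2 u).
  by rewrite -sumrB; apply: eq_bigr => t _; ring.
have err : L * \sum_(t <- T) t.1 * (mon alpha t.2 - ff R t.2 u) <= B * (d%:R ^+ 2 * L ^+ d).
  rewrite mulr_sumr mulr_suml !big_seq; apply: ler_sum => t /homT /eqP td.
  have alpha0 i : alpha i <= (count_mem i u)%:R + 0 by rewrite addr0.
  have [ge le] := ff_mon_bound t.2 (lexx 0) (ltW L0) (fun i => lexx (alpha i)) alpha0 alphaL.
  rewrite mulrCA; apply: le_trans (ler_norm _) _; rewrite normrM ler_wpM2l //.
  rewrite ger0_norm; last by rewrite mulr_ge0 // ltW.
  by move: le; rewrite td add0r -expr2.
rewrite evE mulrBr subr_gt0; apply: le_lt_trans err _.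
rewrite mulrA [ltRHS]mulrCA [ltLHS]mulrC ltr_pM2l ?exprn_gt0 //.
apply: lt_le_trans Be _; rewrite mulrC ler_pM2l //; exact: Te.
Qed.

(* A coefficient of (sum_i y_i)^M T, up to a positive factor, is
   the sum of the falling-factorial version of T over the multiplicities of words. *)
Lemma polya n m (a : 'I_m -> 'rV[int]_n) d (T : seq (R * seq 'I_m)) (e : R) :
  homogeneous d T -> 0 < e -> (forall x, in_simplex x -> e <= form_eval T x) ->
  exists M, forall b, in_kA a (d + M) b -> 0 < mulA_pow a M (form_coef a T) b.
Proof.
move=> homT e0 Te; set B := (\sum_(t <- T) `|t.1|) * d%:R ^+ 2.
have B0 : 0 <= B by rewrite mulr_ge0 ?exprn_ge0 // sumr_ge0.
(* Beyond this threshold e times the word length exceeds B; the successor taken next makes the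
   length visibly positive. *)
have [M0 M0P] : exists M0 : nat, B / e < M0%:R.
  by exists (Num.bound (B / e)); apply: archi_boundP; rewrite divr_ge0 // ltW.
exists M0.+1 => b /in_kAP[v vL vb]; set M := M0.+1 in vL *.
have pos u : size u = (d + M)%nat -> 0 < \sum_(t <- T) t.1 * ff R t.2 u.
  move=> uL; apply: sum_ff_gt0 homT _ Te _; first by rewrite uL addnS.
  rewrite uL [ltRHS]mulrC -ltr_pdivrMr // -/B; apply: lt_le_trans M0P _.
  by rewrite ler_nat; lia.
rewrite mulA_pow_form -(pmulr_rgt0 _ (_ : 0 < ((d + M) ^_ d)%:R)); last first.
  by rewrite ltr0n ffact_gt0 leq_addr.
rewrite mulr_sumr.
have -> : \sum_(t <- T) ((d + M) ^_ d)%:R *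
      (t.1 * sum_words M (fun u => (wt a (t.2 ++ u) == b)%:R)) =
    sum_words (d + M) (fun u => (wt a u == b)%:R * \sum_(t <- T) t.1 * ff R t.2 u).
  transitivity (\sum_(t <- T) sum_words (d + M)
      (fun u => t.1 * (ff R t.2 u * (wt a u == b)%:R))).
    rewrite !big_seq; apply: eq_bigr => t /(allP homT) /eqP td.
    have symw : symmetric_fun (fun u => (wt a u == b)%:R : R).
      by move=> u w uw; rewrite /wt (perm_big _ uw).
    by have := sum_words_ff t.2 M symw; rewrite sum_wordsZ td mulrCA => ->.
  rewrite -sum_words_sum; apply: eq_sum_words => u _.
  by rewrite mulr_sumr; apply: eq_bigr => t _; ring.
apply: (@sum_words_gt0 _ _ _ _ v) => // [u uL|].
  by rewrite mulr_ge0 // ltW // pos.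
by rewrite vb eqxx mul1r pos.
Qed.

(** * Gordan's theorem and vertices *)

Definition dot (K : comPzRingType) n (u v : 'rV[K]_n) : K := \sum_p u 0 p * v 0 p.

Section Dot.
Variables (K : comPzRingType) (n : nat).
Implicit Types u v w : 'rV[K]_n.

Lemma dotC u v : dot u v = dot v u.
Proof. by apply: eq_bigr => p _; rewrite mulrC. Qed.

Lemma dotDr u v w : dot u (v + w) = dot u v + dot u w.
Proof. by rewrite -big_split; apply: eq_bigr => p _; rewrite mxE mulrDr. Qed.

Lemma dotZr c u v : dot u (c *: v) = c * dot u v.
Proof. by rewrite mulr_sumr; apply: eq_bigr => p _; rewrite mxE mulrCA. Qed.

Lemma dot0r u : dot u 0 = 0.
Proof. by rewrite -(scale0r 0) dotZr mul0r. Qed.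

Lemma dotNr u v : dot u (- v) = - dot u v.
Proof. by rewrite -scaleN1r dotZr mulN1r. Qed.

Lemma dotDl u v w : dot (v + w) u = dot v u + dot w u.
Proof. by rewrite ![dot _ u]dotC dotDr. Qed.

Lemma dotZl c u v : dot (c *: v) u = c * dot v u.
Proof. by rewrite ![dot _ u]dotC dotZr. Qed.

Lemma dotNl u v : dot (- v) u = - dot v u.
Proof. by rewrite ![dot _ u]dotC dotNr. Qed.

Lemma dot_sumr (I : Type) (s : seq I) (P : pred I) (v : I -> 'rV[K]_n) u :
  dot u (\sum_(i <- s | P i) v i) = \sum_(i <- s | P i) dot u (v i).
Proof. by apply: (big_morph (dot u) (dotDr u) (dot0r u)). Qed.

End Dot.

Lemma dot_ge0 (F : realDomainType) n (u : 'rV[F]_n) : 0 <= dot u u.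
Proof. by apply: sumr_ge0 => p _; rewrite -expr2 sqr_ge0. Qed.

Lemma dot_eq0 (F : realDomainType) n (u : 'rV[F]_n) : dot u u = 0 -> u = 0.
Proof.
move=> u0; apply/rowP => p; rewrite mxE; apply/eqP; rewrite -sqrf_eq0.
have /psumr_eq0P := u0; rewrite expr2 => -> // q _; exact: sqr_ge0.
Qed.

(** Division is avoided since the result also serves over the integers: c is the product of all
    [x i], and k absorbs every cofactor. *)
Lemma scale_to_pos (F : realDomainType) r (x y : 'I_r -> F) :
  (forall i, 0 < x i) ->
  exists k c, [/\ 0 < k, 0 < c & forall i, 0 < k * x i + c * y i].
Proof.
move=> x0; pose c := \prod_i x i; pose q i := \prod_(j | j != i) x j.
have q0 i : 0 <= `|y i| * q i by rewrite mulr_ge0 // prodr_ge0 // => j _; exact: ltW.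
have S0 : 0 <= \sum_i `|y i| * q i by apply: sumr_ge0.
exists (1 + \sum_i `|y i| * q i), c; split=> [||i].
- by rewrite ltr_pwDl.
- by apply: prodr_gt0.
have -> : c = x i * q i by rewrite /c (bigD1 i).
have : - `|y i| <= y i by rewrite lerNl -normrN ler_norm.
have : `|y i| * q i <= \sum_i `|y i| * q i.
  by rewrite (bigD1 i) //= lerDl sumr_ge0.
have q0' : 0 <= q i by apply: prodr_ge0 => j _; exact: ltW.
move: (x0 i); set S := \sum_i _; set X := x i; set Q := q i; set Y := y i => X0 SQ YN.
have -> : (1 + S) * X + X * Q * Y = X * (1 + (S - `|Y| * Q) + Q * (`|Y| + Y)) by ring.
rewrite mulr_gt0 // ltr_pwDl // ?mulr_ge0 //; last by rewrite -lerBlDl sub0r.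
by rewrite ltr_pwDl // subr_ge0.
Qed.

(* The induction projects along d 0 when a functional positive on
   the other vectors is nonpositive on d 0. *)
Lemma gordan (F : realDomainType) n r (d : 'I_r -> 'rV[F]_n) :
  (exists w, forall i, 0 < dot w (d i)) \/
  (exists l : 'I_r -> F,
     [/\ forall i, 0 <= l i, exists i, 0 < l i & \sum_i l i *: d i = 0]).
Proof.
elim: r d => [|r IHr] d; first by left; exists 0 => -[].
pose d0 := d ord0; pose d' i := d (lift ord0 i).
have [d00|d0n] := eqVneq d0 0.
  right; exists (fun i => (i == ord0)%:R); split=> [i||]; first exact: ler0n.
    by exists ord0; rewrite ltr01.
  rewrite big_ord_recl /= -/d0 d00 scaler0 add0r big1 // => i _.
  by rewrite scale0r.
have [[w wP]|[l [l0 lpos ldep]]] := IHr d'; last first.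
  right; exists (fun i => if unlift ord0 i is Some j then l j else 0).
  split=> [i||]; first by case: unliftP.
    by have [j lj] := lpos; exists (lift ord0 j); rewrite liftK.
  rewrite big_ord_recl unlift_none scale0r add0r -[RHS]ldep.
  by apply: eq_bigr => i _; rewrite liftK.
have [wd0|wd0] := ltP 0 (dot w d0).
  by left; exists w => i; case: (unliftP ord0 i) => [j|] ->; [exact: wP|].
pose c := dot w d0; pose e i := dot w (d' i) *: d0 - c *: d' i.
have [[w' w'P]|[l [l0 [i li] ldep]]] := IHr e; last first.
  (* A relation among the projections, expanded in the vectors d, has nonnegative coefficients since
     c is at most 0 and w is positive on every [d' i]. *)
  pose q i := if unlift ord0 i is Some j then - c * l j else \sum_j l j * dot w (d' j).
  have S0 : 0 < \sum_j l j * dot w (d' j).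
    rewrite (bigD1 i) //= ltr_pwDl ?mulr_gt0 // sumr_ge0 // => j _.
    by rewrite mulr_ge0 // ltW.
  right; exists q; split=> [j||].
  - rewrite /q; case: unliftP => [j' _|_]; last exact: ltW.
    by rewrite mulr_ge0 // oppr_ge0.
  - by exists ord0; rewrite /q unlift_none.
  rewrite big_ord_recl /q unlift_none -[RHS]ldep scaler_suml -big_split /=.
  apply: eq_bigr => j _; rewrite liftK scalerBr !scalerA -/d0 -/(d' j).
  by rewrite mulNr scaleNr [c * _]mulrC.
(* [w1] vanishes on [d0] and takes on [d' i] the value of [w'] on [e i]; adding a multiple of [d0]
   to a multiple of it gives positivity everywhere. *)
pose w1 := (- c) *: w' + dot w' d0 *: w.
have w1d0 : dot w1 d0 = 0 by rewrite /w1 dotDl !dotZl -/c; ring.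
have w1d' i : 0 < dot w1 (d' i).
  have := w'P i; rewrite /e /w1 dotDr dotNr !dotZr dotDl !dotZl.
  by congr (0 < _); ring.
have [k [c' [k0 c0 kc]]] := scale_to_pos (fun i => dot d0 (d' i)) w1d'.
left; exists (k *: w1 + c' *: d0) => i; rewrite dotDl !dotZl.
case: (unliftP ord0 i) => [j|] ->; first exact: kc.
rewrite -/d0 w1d0 mulr0 add0r mulr_gt0 // lt_def dot_ge0 andbT.
by apply: contraNneq d0n => /dot_eq0 ->.
Qed.

Definition vertex n m (a : 'I_m -> 'rV[int]_n) (v : 'I_m) : Prop :=
  forall w, wt a w = a v *+ size w -> all (pred1 v) w.

(* A convex combination of points of norm at most |a v| equals a v only if all the
   points are a v. *)
Lemma max_norm_vertex n m (a : 'I_m -> 'rV[int]_n) (P : pred 'I_m) v :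
  injective a -> (forall j, P j -> dot (a j) (a j) <= dot (a v) (a v)) ->
  (forall w, wt a w = a v *+ size w -> all P w) -> vertex a v.
Proof.
move=> a_inj vmax Pw w wE.
have wP := allP (Pw w wE).
have sum0 : \sum_(j <- w) dot (a j - a v) (a j - a v) <= 0.
  (* |a_j - a_v|^2 is |a_j|^2 - |a_v|^2 minus twice a_v . (a_j - a_v), and this linear term sums to
     zero over w. *)
  have -> : \sum_(j <- w) dot (a j - a v) (a j - a v) =
      \sum_(j <- w) (dot (a j) (a j) - dot (a v) (a v)).
    apply/eqP; rewrite -subr_eq0 -sumrB.
    have -> : \sum_(j <- w) (dot (a j - a v) (a j - a v) - (dot (a j) (a j) - dot (a v) (a v))) =
       \sum_(j <- w) dot (- (a v *+ 2)) (a j - a v).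
      apply: eq_bigr => j _.
      rewrite !dotDr !dotDl !dotNr !dotNl mulr2n !dotDl.
      by rewrite (dotC (a j) (a v)); ring.
    rewrite -dot_sumr sumrB -/(wt a w) wE big_const_seq count_predT iter_addr_0.
    by rewrite subrr dot0r.
  rewrite big_seq; apply: sumr_le0 => j /wP Pj; rewrite subr_le0; exact: vmax.
apply/allP => j jw; apply/eqP/a_inj/eqP; rewrite -subr_eq0; apply/eqP/dot_eq0.
apply/eqP; rewrite eq_le dot_ge0 andbT; apply: le_trans sum0.
rewrite (big_rem j) //= lerDl sumr_ge0 // => i _; exact: dot_ge0.
Qed.

(** * The nonnegative part of Y and the binomial equations *)

Definition binomial n m (a : 'I_m -> 'rV[int]_n) (K : pzRingType) (x : 'I_m -> K) :=
  forall w w', size w = size w' -> wt a w = wt a w' -> mon x w = mon x w'.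

Lemma mon_torus_pt n m (a : 'I_m -> 'rV[int]_n) u (t : 'I_n -> R[i]) w :
  (forall l, t l != 0) ->
  mon (torus_pt a u t) w = u ^+ size w * \prod_l t l ^ (wt a w 0 l).
Proof.
move=> t0; elim: w => [|i w IHw].
  by rewrite /mon /wt !big_nil mul1r big1 // => l _; rewrite mxE expr0z.
rewrite mon_cons IHw exprS mulrACA -big_split; congr (_ * _).
by apply: eq_bigr => l _; rewrite wt_cons mxE expfzDr.
Qed.

Lemma mon_complex m (y : 'I_m -> R) w : mon (fun j => (y j)%:C%C) w = (mon y w)%:C%C.
Proof. by rewrite /mon rmorph_prod. Qed.

(** On the torus image a monomial depends only on its length and weight, so the binomial is a
    polynomial vanishing there. *)
Lemma in_Y_binomial n m (a : 'I_m -> 'rV[int]_n) (y : 'I_m -> R) :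
  in_Y a (fun j => (y j)%:C%C) -> binomial a y.
Proof.
move=> yY w w' sw ww'.
pose p : {mpoly R[i][m]} := \prod_(i <- w) 'X_i - \prod_(i <- w') 'X_i.
have pE (z : 'I_m -> R[i]) : p.@[z] = mon z w - mon z w'.
  rewrite mevalB !rmorph_prod.
  by congr (_ - _); apply: eq_bigr => i _; rewrite /= mevalXU.
have := yY p; rewrite pE !mon_complex => /(_ _)/eqP; rewrite subr_eq0 => yE.
apply/(@complexI _)/eqP/yE => u t _ t0.
by rewrite pE !mon_torus_pt // sw ww' subrr.
Qed.

(** Newton interpolation: a new node is served by a multiple of a polynomial vanishing at the older
    ones. Repeated nodes are harmless if g agrees there. *)
Lemma interpolation (F : fieldType) (T : eqType) (s : seq T) (q g : T -> F) :
  {in s &, forall x y, q x = q y -> g x = g y} ->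
  exists Q : {poly F}, {in s, forall x, Q.[q x] = g x}.
Proof.
elim: s => [|x s IHs] compat; first by exists 0.
have [|Q QP] := IHs; first by move=> y z ys zs; apply: compat; rewrite inE ?ys ?zs orbT.
have [xs|xs] := boolP (q x \in map q s).
  exists Q => y; rewrite inE => /predU1P[->|/QP //].
  have /mapP[z zs qxz] := xs; rewrite qxz QP //.
  by apply/esym/compat; rewrite ?inE ?eqxx ?zs ?orbT.
pose P := \prod_(z <- map q s) ('X - z%:P).
have Px : P.[q x] != 0 by rewrite -/(root P (q x)) root_prod_XsubC.
exists (Q + ((g x - Q.[q x]) / P.[q x]) *: P) => y.
rewrite inE hornerD hornerZ => /predU1P[->|ys].
  by rewrite divfK // addrC subrK.
have /eqP -> : P.[q y] == 0 by rewrite -/(root P (q y)) root_prod_XsubC map_f.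
by rewrite mulr0 addr0 QP.
Qed.

(** The integers 0, ..., [size p] - 1 are too many to all be roots. *)
Lemma exists_non_root (p : {poly int}) : p != 0 -> exists B, ~~ root p B.
Proof.
move=> p0; have [/existsP[i ri]|] := boolP [exists i : 'I_(size p), ~~ root p (i : nat)%:Z].
  by exists (i : nat)%:Z.
rewrite negb_exists => /forallP all_root.
have := @max_poly_roots _ p (map Posz (iota 0 (size p))) p0.
rewrite size_map size_iota ltnn map_inj_uniq ?iota_uniq; last by move=> i j [].
move=> /(_ _ isT) bot; exfalso; suff: false by [].
apply: bot; apply/allP => _ /mapP[i + ->]; rewrite mem_iota add0n => /andP[_ ip].
by have := all_root (Ordinal ip); rewrite negbK.
Qed.

(** Packs the weight (degrees below n) and the length (degree n) into one polynomial, so that one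
    integer value can determine both. *)
Definition weight_poly n m (a : 'I_m -> 'rV[int]_n) (w : seq 'I_m) : {poly int} :=
  rVpoly (wt a w) + (size w)%:Z *: 'X^n.

Lemma weight_polyP n m (a : 'I_m -> 'rV[int]_n) w w' :
  weight_poly a w = weight_poly a w' -> size w = size w' /\ wt a w = wt a w'.
Proof.
move=> E; split.
  have := congr1 (fun p : {poly int} => p`_n) E.
  rewrite !coefD !coefZ coefXn eqxx !mulr1 !coef_rVpoly.
  by case: insubP => [i|_]; rewrite ?ltnn // !add0r => -[].
apply: (can_inj (@rVpolyK _ _)).
apply/polyP => i; have := congr1 (fun p : {poly int} => p`_i) E.
rewrite !coefD !coefZ coefXn; have [->|] := eqVneq i n; last by rewrite !mulr0 !addr0.
by rewrite !coef_rVpoly; case: insubP => [j|_]; rewrite ?ltnn.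
Qed.

(** B is a non-root of the product of all differences of distinct members of s. *)
Lemma separating_int (s : seq {poly int}) :
  exists B : int, {in s &, injective (fun p : {poly int} => p.[B])}.
Proof.
pose P := \prod_(p <- s) \prod_(q <- s | q != p) (p - q).
have P0 : P != 0.
  rewrite prodf_seq_neq0; apply/allP => p _ /=.
  by rewrite prodf_seq_neq0; apply/allP => q _ /=; apply/implyP; rewrite subr_eq0 eq_sym.
have [B nB] := exists_non_root P0; exists B => p q ps qs /= pq.
apply/eqP; apply: contraNT nB => npq; rewrite /root /P horner_prod prodf_seq_eq0.
apply/hasP; exists p => //=; rewrite horner_prod prodf_seq_eq0.
apply/hasP; exists q => //=; rewrite eq_sym npq /=.
by rewrite hornerD hornerN pq subrr.
Qed.

Definition mnm_word m (mu : 'X_{1..m}) : seq 'I_m :=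
  flatten [seq nseq (mu i) i | i <- enum 'I_m].

Lemma mon_mnm_word (K : comPzRingType) m (x : 'I_m -> K) (mu : 'X_{1..m}) :
  mon x (mnm_word mu) = \prod_i x i ^+ mu i.
Proof.
rewrite /mon big_flatten big_map big_enum; apply: eq_bigr => i _.
exact: mon_nseq.
Qed.

(* A polynomial vanishing on the torus image is evaluated at the points whose coordinates
   are powers of 2^(B^l), where B separates the exponents that occur: the monomials take
   values q and all power sums of the q, weighted by the coefficients, vanish. *)
Lemma binomial_in_Y n m (a : 'I_m -> 'rV[int]_n) (x : 'I_m -> R[i]) :
  binomial a x -> in_Y a x.
Proof.
move=> xbin p pY; pose s := msupp p.
pose c (mu : 'X_{1..m}) := p@_mu; pose wd := @mnm_word m.
have evE (z : 'I_m -> R[i]) : p.@[z] = \sum_(mu <- s) c mu * mon z (wd mu).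
  by rewrite mevalE; apply: eq_bigr => mu _; rewrite mon_mnm_word.
have [B Binj] := separating_int (map (weight_poly a \o wd) s).
have two_gt0 : 0 < 2 :> R[i] by rewrite ltr0n.
have two_neq0 : 2 != 0 :> R[i] by rewrite gt_eqF.
(* At this torus point each monomial is 2 to the power of its [weight_poly] at B. *)
pose u : R[i] := 2 ^ (B ^+ n); pose t (l : 'I_n) : R[i] := 2 ^ (B ^+ l).
have t0 l : t l != 0 by apply: expfz_neq0.
pose q mu := mon (torus_pt a u t) (wd mu).
have qE mu : q mu = 2 ^ (weight_poly a (wd mu)).[B].
  rewrite /q mon_torus_pt // /weight_poly hornerD hornerZ hornerXn expfzDr // mulrC.
  congr (_ * _).
    rewrite /rVpoly horner_poly.
    rewrite (big_morph (fun z : int => (2 : R[i]) ^ z)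
      (fun z z' => expfzDr z z' two_neq0) (expr0z 2)).
    apply: eq_bigr => l _; rewrite /t exprz_exp mulrC.
    by case: insubP => [l' _ /val_inj -> //|]; rewrite ltn_ord.
  by rewrite [LHS]exprnP exprz_exp mulrC.
(* Equal values of q force equal length and weight, hence equal monomials at x, so these are a
   polynomial function of q. *)
have [|Q QP] := @interpolation _ _ s q (fun mu => mon x (wd mu)).
  have two_inj : injective (fun z : int => (2 : R[i]) ^ z).
    have twoE z : (2 : R[i]) ^ z = ((2%:R : R) ^ z)%:C%C.
      by rewrite fmorphXz rmorph_nat.
    move=> z z'; rewrite /= !twoE => /(@complexI _); apply: ieexprIz => //.
    by rewrite gt_eqF // ltr1n.
  move=> mu nu mus nus; rewrite !qE => /two_inj.
  have mapwd (nu' : 'X_{1..m}) :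
      nu' \in s -> weight_poly a (wd nu') \in map (weight_poly a \o wd) s.
    exact: (map_f (weight_poly a \o wd)).
  by move=> /(Binj _ _ (mapwd _ mus) (mapwd _ nus))/weight_polyP[]; exact: xbin.
rewrite evE; transitivity (\sum_(mu <- s) c mu * Q.[q mu]).
  by rewrite !big_seq; apply: eq_bigr => mu /QP ->.
transitivity (\sum_(r < size Q) Q`_r * \sum_(mu <- s) c mu * q mu ^+ r).
  under eq_bigr do rewrite horner_coef mulr_sumr.
  rewrite exchange_big; apply: eq_bigr => r _ /=.
  by rewrite mulr_sumr; apply: eq_bigr => mu _; rewrite mulrCA.
apply: big1 => r _; rewrite -[RHS](mulr0 (Q`_r)); congr (_ * _).
(* The r-th power sum is p at the torus point with parameters u^r and t^r. *)
rewrite -[RHS](pY (u ^+ r) (fun l => t l ^+ r)).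
- rewrite evE; apply: eq_bigr => mu _; congr (_ * _).
  rewrite /q !mon_torus_pt //; last by move=> l; rewrite expf_neq0.
  rewrite exprMn exprAC -prodrXl; congr (_ * _); apply: eq_bigr => l _.
  exact: (exprzAC (t l) _ (Posz r)).
- by rewrite expf_neq0 // expfz_neq0.
- by move=> l; rewrite expf_neq0.
Qed.

(** * Newton polytopes *)

Definition intr_row n (b : 'rV[int]_n) : 'rV[R]_n := map_mx intr b.

Lemma dot_intr_row n (u v : 'rV[int]_n) :
  dot (intr_row u) (intr_row v) = (dot u v)%:~R.
Proof. by rewrite /dot rmorph_sum; apply: eq_bigr => p _; rewrite !mxE rmorphM. Qed.

(** Gordan's theorem for the vectors b - x: without a strictly separating functional there is a
    nonnegative dependence, and dividing it by its total gives a convex combination. *)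
Lemma in_conv_separation n (s : seq 'rV[int]_n) (x : 'I_n -> R) :
  in_conv s x <-> forall w, has (fun b => dot w (intr_row b) <= dot w (\row_p x p)) s.
Proof.
split=> [[l [l0 l1 xl]] w|sep].
  apply: contraT => /hasPn noS.
  have : \sum_i l i * (dot w (intr_row (nth 0 s i)) - dot w (\row_p x p)) = 0.
    have -> : \row_p x p = \sum_i l i *: intr_row (nth 0 s i).
      by apply/rowP => p; rewrite mxE xl summxE; apply: eq_bigr => i _; rewrite !mxE.
    under eq_bigr do rewrite mulrBr -dotZr.
    by rewrite sumrB -mulr_suml l1 mul1r dot_sumr subrr.
  have pos (i : 'I_(size s)) : 0 < dot w (intr_row (nth 0 s i)) - dot w (\row_p x p).
    by rewrite subr_gt0 ltNge; exact: (noS _ (mem_nth 0 (ltn_ord i))).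
  move=> /(psumr_eq0P (fun i _ => mulr_ge0 (l0 i) (ltW (pos i)))) l0'.
  have {}l0' i : l i = 0.
    by have /eqP := l0' i isT; rewrite mulf_eq0 (gt_eqF (pos i)) orbF => /eqP.
  by move/eqP: l1; rewrite big1 // eq_sym oner_eq0.
have [[w wP]|[l [l0 [i li] ldep]]] :=
    gordan (fun i : 'I_(size s) => intr_row (nth 0 s i) - \row_p x p).
  have /hasP[b bs] := sep w; rewrite leNgt => /negP[].
  have := wP (Ordinal (etrans (index_mem b s) bs)).
  by rewrite /= nth_index // dotDr dotNr subr_gt0.
have S0 : 0 < \sum_j l j.
  by rewrite (bigD1 i) //= ltr_pwDl // sumr_ge0.
have SN0 : \sum_j l j != 0 by rewrite gt_eqF.
exists (fun j => l j / \sum_j l j); split=> [j||p].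
- by rewrite divr_ge0 // ltW.
- by rewrite -mulr_suml divff.
apply: (mulfI SN0); rewrite mulr_sumr.
have := congr1 (fun u : 'rV[R]_n => u 0 p) ldep; rewrite summxE mxE.
under eq_bigr do rewrite !mxE mulrBr.
rewrite sumrB mulr_suml => /subr0_eq <-; apply: eq_bigr => j _.
by rewrite [RHS]mulrA [X in _ = X * _]mulrC divfK.
Qed.

Lemma max_norm_in n m (a : 'I_m -> 'rV[int]_n) (P : pred 'I_m) j : P j ->
  exists2 v, P v & forall j, P j -> dot (a j) (a j) <= dot (a v) (a v).
Proof.
move=> Pj; exists [arg max_(i > j | P i) dot (a i) (a i)]%O; case: arg_maxP => //.
Qed.

(** Take a minimizer of maximal norm. The letters of a word of weight L a_v and length L average to
    the minimum, so all are minimizers and [max_norm_vertex] applies. *)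
Lemma vertex_min_dot n m (a : 'I_m -> 'rV[int]_n) (w : 'rV[R]_n) :
  injective a -> (0 < m)%nat ->
  exists2 v, vertex a v & forall j, dot w (intr_row (a v)) <= dot w (intr_row (a j)).
Proof.
move=> a_inj m0; pose h j := dot w (intr_row (a j)).
have [i0 i0P] : exists i0, forall j, h i0 <= h j.
  by exists [arg min_(i < Ordinal m0) h i]%O; case: arg_minP => // i _ iP j; exact: (iP j isT).
have [v /= /eqP vi vmax] := @max_norm_in _ _ a (fun j => h j == h i0) i0 (eqxx _).
exists v => [|j]; last by have := i0P j; rewrite -vi.
apply: (max_norm_vertex a_inj vmax) => u uE.
have sum0 : \sum_(j <- u) (h j - h v) = 0.
  rewrite sumrB -dot_sumr.
  have -> : \sum_(j <- u) intr_row (a j) = intr_row (wt a u) by rewrite /wt /intr_row map_mx_sum.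
  rewrite uE big_const_seq count_predT iter_addr_0.
  suff -> : dot w (intr_row (a v *+ size u)) = h v *+ size u by rewrite subrr.
  by rewrite /intr_row raddfMn /= -scaler_nat dotZr mulr_natl.
apply/allP => j ju; move: sum0 => /eqP; rewrite psumr_eq0 => [/allP/(_ j ju)|i _].
  by rewrite subr_eq0 vi.
by rewrite subr_ge0 vi.
Qed.

Lemma supportP n m (a : 'I_m -> 'rV[int]_n) k f b :
  b \in Defs.support a k f <-> in_kA a k b /\ f b != 0.
Proof. by rewrite mem_filter mem_kA andbC; split=> [/andP[]|[-> ->]]. Qed.

Lemma in_kA_mulrn n m (a : 'I_m -> 'rV[int]_n) k v : in_kA a k (a v *+ k).
Proof. by apply/in_kAP; exists (nseq k v); rewrite ?size_nseq ?wt_nseq. Qed.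

(** Each linear functional is minimal over k.A at some k a_v with v a vertex, and these points lie
    in the support. *)
Lemma newt_eq_of_vertices n m (a : 'I_m -> 'rV[int]_n) k f :
  injective a -> (0 < m)%nat ->
  (forall v, vertex a v -> f (a v *+ k) != 0) -> newt_eq_conv_kA a k f.
Proof.
move=> a_inj m0 fV x; rewrite !in_conv_separation; split=> sep w; have /hasP[b bS bx] := sep w.
  by apply/hasP; exists b; rewrite // mem_kA; have /supportP[] := bS.
have [v vV vmin] := vertex_min_dot w a_inj m0.
apply/hasP; exists (a v *+ k).
  by apply/supportP; split; [exact: in_kA_mulrn | exact: fV].
apply: le_trans bx; move: bS; rewrite mem_kA => /in_kAP[u uk <-].
rewrite -wt_nseq /wt /intr_row !map_mx_sum !dot_sumr.
rewrite -uk -/(size u); elim: u {uk} => [|j u IHu]; first by rewrite !big_nil.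
by rewrite /= !big_cons lerD //; exact: vmin.
Qed.

(** Otherwise Gordan's theorem over the integers gives support points with natural multiplicities
    averaging to k a_v. Concatenated words for them must be constant, which puts k a_v itself in the
    support. *)
Lemma vertex_newt_eq n m (a : 'I_m -> 'rV[int]_n) k f v :
  newt_eq_conv_kA a k f -> vertex a v -> f (a v *+ k) != 0.
Proof.
move=> newt vV; apply/negP => /eqP fv0; pose b0 := a v *+ k.
have b0S : in_conv (Defs.support a k f) (fun p => (b0 0 p)%:~R).
  apply/newt/in_conv_separation => w; apply/hasP; exists b0.
    by rewrite mem_kA in_kA_mulrn.
  by rewrite le_eqVlt; apply/orP; left; apply/eqP; congr dot; apply/rowP => p; rewrite !mxE.
set S := Defs.support a k f in b0S.
have Sk (i : 'I_(size S)) : in_kA a k (nth 0 S i) /\ f (nth 0 S i) != 0.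
  by apply/supportP/mem_nth.
have /fin_all_exists2[s sk sw] (i : 'I_(size S)) :
    exists2 u, size u = k & wt a u = nth 0 S i.
  by apply/in_kAP; case: (Sk i).
have [[w wP]|[l [l0 [i li] ldep]]] := gordan (fun i : 'I_(size S) => nth 0 S i - b0).
  move/in_conv_separation/(_ (intr_row w))/hasP : b0S => [b bS].
  have -> : \row_p (b0 0 p)%:~R = intr_row b0 by apply/rowP => p; rewrite !mxE.
  rewrite !dot_intr_row ler_int leNgt => /negP[].
  have := wP (Ordinal (etrans (index_mem b S) bS)).
  by rewrite /= nth_index // dotDr dotNr subr_gt0.
pose W := flatten [seq flatten (nseq `|l j|%nat (s j)) | j <- enum 'I_(size S)].
have wtW : wt a W = a v *+ size W.
  have -> : wt a W = \sum_(j < size S) nth 0 S j *+ `|l j|%nat.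
    rewrite /wt /W big_flatten big_map big_enum /=; apply: eq_bigr => j _.
    rewrite big_flatten big_nseq /= -/(wt a (s j)) sw.
    by rewrite iter_addr_0.
  have -> : a v *+ size W = \sum_(j < size S) b0 *+ `|l j|%nat.
    rewrite /W size_flatten /shape -map_comp sumnE big_map big_enum /= -sumrMnr.
    apply: eq_bigr => j _.
    by rewrite size_flatten /shape map_nseq sumn_nseq sk /b0 -mulrnA.
  apply/eqP; rewrite -subr_eq0 -sumrB -[X in _ == X]ldep; apply/eqP/eq_bigr => j _.
  rewrite -mulrnBl -scaler_nat; congr (_ *: _).
  by rewrite natz gez0_abs.
have sv : all (pred1 v) (s i).
  apply/allP => j js; apply: (allP (vV W wtW)); apply/flattenP.
  exists (flatten (nseq `|l i|%nat (s i))); first by apply/mapP; exists i; rewrite ?mem_enum.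
  apply/flattenP; exists (s i) => //; rewrite mem_nseq eqxx andbT absz_gt0.
  by rewrite gt_eqF.
have [_ /negP[]] := Sk i; rewrite -sw.
by have /all_pred1P -> := sv; rewrite sk wt_nseq fv0.
Qed.

(** A word of length L and weight L a_v has the nonzero value y_v^L, so all its letters are nonzero
    coordinates of y. *)
Lemma vertex_of_binomial n m (a : 'I_m -> 'rV[int]_n) (K : idomainType) (y : 'I_m -> K) :
  injective a -> binomial a y -> (exists j, y j != 0) ->
  exists2 v, vertex a v & y v != 0.
Proof.
move=> a_inj ybin [j yj].
have [v yv vmax] := @max_norm_in _ _ a (fun j => y j != 0) j yj.
exists v => //; apply: (max_norm_vertex a_inj vmax) => w wE.
have : mon y w != 0.
  rewrite (ybin w (nseq (size w) v)) ?size_nseq ?wt_nseq //.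
  by rewrite mon_nseq expf_neq0.
by rewrite /mon prodf_seq_neq0.
Qed.

(** * Forms representing f *)

Lemma supported_mulA n m (a : 'I_m -> 'rV[int]_n) k f :
  supported_in a k f -> supported_in a k.+1 (Defs.mulA a f).
Proof.
move=> fS b; have [/existsP[i /fS /in_kAP[w wk wb]] _|] := boolP [exists i, f (b - a i) != 0].
  by apply/in_kAP; exists (i :: w); rewrite /= ?wk // wt_cons wb addrC subrK.
rewrite negb_exists => /forallP f0 /eqP[]; apply: big1 => i _.
by have := f0 i; rewrite negbK => /eqP.
Qed.

Lemma supported_mulA_pow n m (a : 'I_m -> 'rV[int]_n) k N f :
  supported_in a k f -> supported_in a (k + N) (mulA_pow a N f).
Proof.
move=> fS; elim: N => [|N IHN]; first by rewrite addn0.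
by rewrite addnS; apply: supported_mulA.
Qed.

(** (k+1) a_v is a_i plus a point of k.A only for i = v. *)
Lemma mulA_vertex n m (a : 'I_m -> 'rV[int]_n) k f v :
  vertex a v -> supported_in a k f -> Defs.mulA a f (a v *+ k.+1) = f (a v *+ k).
Proof.
move=> vV fS; rewrite /Defs.mulA (bigD1 v) //= big1 => [|i iv].
  by rewrite addr0 mulrSr addrK.
apply/eqP; apply: contraNT iv => /fS /in_kAP[w wk wE].
by have := vV (i :: w); rewrite /= wk wt_cons wE addrC subrK => /(_ erefl)/andP[].
Qed.

Lemma mulA_pow_vertex n m (a : 'I_m -> 'rV[int]_n) k N f v :
  vertex a v -> supported_in a k f ->
  mulA_pow a N f (a v *+ (k + N)) = f (a v *+ k).
Proof.
move=> vV fS; elim: N => [|N IHN]; first by rewrite addn0.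
by rewrite addnS -IHN; apply: mulA_vertex => //; exact: supported_mulA_pow.
Qed.

Lemma exists_kA_section n m (a : 'I_m -> 'rV[int]_n) k : (0 < m)%nat ->
  exists w : 'rV[int]_n -> k.-tuple 'I_m, forall b, in_kA a k b -> sumA a (w b) = b.
Proof.
(* Outside k.A a constant word serves as dummy value. *)
move=> m0; exists (fun b => odflt (nseq_tuple k (Ordinal m0)) [pick s | sumA a s == b]) => b.
by move=> /existsP[s sb]; case: pickP => [s' /eqP //|/(_ s)]; rewrite sb.
Qed.

Definition hat_form n m (a : 'I_m -> 'rV[int]_n) k (f : 'rV[int]_n -> R)
    (w : 'rV[int]_n -> k.-tuple 'I_m) : seq (R * seq 'I_m) :=
  [seq (f b, tval (w b)) | b <- kA a k].

Lemma form_eval_hat n m (a : 'I_m -> 'rV[int]_n) k f (w : 'rV[int]_n -> k.-tuple 'I_m) y :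
  form_eval (hat_form a f w) y = fhat a f w y.
Proof.
by rewrite /form_eval big_map; apply: eq_bigr => b _; rewrite /mon big_tuple.
Qed.

Lemma homogeneous_hat n m (a : 'I_m -> 'rV[int]_n) k f (w : 'rV[int]_n -> k.-tuple 'I_m) :
  homogeneous k (hat_form a f w).
Proof. by apply/allP => _ /mapP[b _ ->]; rewrite /= size_tuple. Qed.

Lemma sum_indicator (T : eqType) (K : pzRingType) (s : seq T) (g : T -> K) x :
  uniq s -> x \in s -> \sum_(b <- s) g b * (b == x)%:R = g x.
Proof.
move=> su xs; rewrite (bigD1_seq x) //= eqxx mulr1 big1 ?addr0 // => b /negbTE ->.
exact: mulr0.
Qed.

Lemma form_coef_hat n m (a : 'I_m -> 'rV[int]_n) k f (w : 'rV[int]_n -> k.-tuple 'I_m) b :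
  supported_in a k f -> (forall b, in_kA a k b -> sumA a (w b) = b) ->
  form_coef a (hat_form a f w) b = f b.
Proof.
move=> fS wP; rewrite /form_coef big_map /=.
transitivity (\sum_(b' <- kA a k) f b' * (b' == b)%:R).
  by rewrite !big_seq; apply: eq_bigr => b'; rewrite mem_kA -sumAE => /wP ->.
have [bk|bk] := boolP (b \in kA a k); first by rewrite sum_indicator ?undup_uniq.
have -> : f b = 0.
  by apply/eqP; apply: contraNT bk; rewrite mem_kA; exact: fS.
rewrite big_seq; apply: big1 => b' b'k; case: eqVneq => [b'b|_]; last exact: mulr0.
by rewrite -b'b b'k in bk.
Qed.

Lemma mon_indicator m (K : pzRingType) (v : 'I_m) w :
  mon (fun j => (j == v)%:R : K) w = (all (pred1 v) w)%:R.
Proof.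
elim: w => [|j w IHw]; first by rewrite /mon big_nil.
by rewrite mon_cons IHw /=; case: (j == v); rewrite ?mul1r ?mul0r.
Qed.

(** Of two words of equal length and weight, either both are constantly v or neither is. *)
Lemma binomial_vertex n m (a : 'I_m -> 'rV[int]_n) (K : pzRingType) v :
  vertex a v -> binomial a (fun j => (j == v)%:R : K).
Proof.
move=> vV.
have all_v (w w' : seq 'I_m) : size w = size w' -> wt a w = wt a w' ->
    all (pred1 v) w -> all (pred1 v) w'.
  by move=> sw ww' /all_pred1P wE; apply: vV; rewrite -ww' wE wt_nseq sw.
move=> w w' sw ww'; rewrite !mon_indicator; congr (_ %:R); congr nat_of_bool.
by apply/idP/idP; [exact: all_v | apply: all_v].
Qed.

Lemma binomial_complex n m (a : 'I_m -> 'rV[int]_n) (y : 'I_m -> R) :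
  binomial a y -> binomial a (fun j => (y j)%:C%C).
Proof.
move=> yb w w' sw ww'.
by rewrite !mon_complex (yb w w').
Qed.

(** The coordinate point of v lies on Y, and [fhat] reduces there to its term at k a_v. *)
Lemma copositive_vertex_gt0 n m (a : 'I_m -> 'rV[int]_n) k f v : (0 < m)%nat ->
  strictly_A_copositive a k f -> vertex a v -> 0 < f (a v *+ k).
Proof.
move=> m0 cop vV; have [w wP] := exists_kA_section a k m0.
pose y j : R := (j == v)%:R.
have := cop y (fun j => ler0n _ _) _ _ w wP.
rewrite -form_eval_hat /form_eval big_map /=.
have -> : \sum_(b <- kA a k) f b * mon y (w b) =
    \sum_(b <- kA a k) f b * (b == a v *+ k)%:R.
  rewrite !big_seq; apply: eq_bigr => b; rewrite mem_kA => /wP; rewrite sumAE => wb.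
  rewrite mon_indicator; congr (_ * (_ : bool)%:R); apply/idP/eqP => [/all_pred1P wE|bE].
    by rewrite -[LHS]wb wE wt_nseq size_tuple.
  by apply: vV; rewrite wb size_tuple.
rewrite sum_indicator ?undup_uniq ?mem_kA ?in_kA_mulrn //; apply.
  by exists v; rewrite /y eqxx oner_neq0.
by apply: binomial_in_Y; apply: binomial_complex; exact: binomial_vertex.
Qed.

(** * Homogenization and squares of binomials *)

Definition mul_form (K : Type) m (T : seq (K * seq 'I_m)) : seq (K * seq 'I_m) :=
  [seq (t.1, i :: t.2) | t <- T, i <- enum 'I_m].

Lemma form_eval_mul (K : comPzRingType) m (T : seq (K * seq 'I_m)) x :
  form_eval (mul_form T) x = (\sum_i x i) * form_eval T x.
Proof.
rewrite /form_eval big_allpairs_dep mulr_sumr /=; apply: eq_bigr => t _.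
rewrite big_enum mulr_suml; apply: eq_bigr => i _.
by rewrite mon_cons mulrCA.
Qed.

Lemma form_coef_mul n m (a : 'I_m -> 'rV[int]_n) (T : seq (R * seq 'I_m)) b :
  form_coef a (mul_form T) b = Defs.mulA a (form_coef a T) b.
Proof.
rewrite /form_coef big_allpairs_dep /Defs.mulA [RHS]exchange_big /=; apply: eq_bigr => t _.
rewrite big_enum; apply: eq_bigr => i _.
by rewrite wt_cons addrC [RHS]/= eq_sym -subr_eq eq_sym.
Qed.

Lemma homogeneous_mul (K : eqType) m d (T : seq (K * seq 'I_m)) :
  homogeneous d T -> homogeneous d.+1 (mul_form T).
Proof.
by move=> /allP hT; apply/allP => _ /allpairsPdep[t [i [tT _ ->]]] /=; rewrite eqSS hT.
Qed.

(** Multiplying by the sum of the variables raises the degree but keeps the values on the simplex,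
    where that sum is 1. *)
Lemma iter_mul_form n m (a : 'I_m -> 'rV[int]_n) d N (T : seq (R * seq 'I_m)) :
  homogeneous d T ->
  [/\ homogeneous (d + N) (iter N (@mul_form R m) T),
      forall x, in_simplex x -> form_eval (iter N (@mul_form R m) T) x = form_eval T x &
      forall b, form_coef a (iter N (@mul_form R m) T) b = mulA_pow a N (form_coef a T) b].
Proof.
move=> hT; elim: N => [|N [IH1 IH2 IH3]]; first by rewrite addn0.
split=> [|x xS|b]; first by rewrite addnS; exact: homogeneous_mul.
  by rewrite iterS form_eval_mul IH2 //; case: xS => _ ->; rewrite mul1r.
rewrite iterS form_coef_mul /mulA_pow iterS; apply: eq_bigr => i _; exact: IH3.
Qed.

Definition scale_form m (c : R) (T : seq (R * seq 'I_m)) :=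
  [seq (c * t.1, t.2) | t <- T].

Lemma form_eval_scale m c (T : seq (R * seq 'I_m)) x :
  form_eval (scale_form c T) x = c * form_eval T x.
Proof. by rewrite /form_eval big_map mulr_sumr; apply: eq_bigr => t _; rewrite mulrA. Qed.

Lemma form_coef_scale n m (a : 'I_m -> 'rV[int]_n) c (T : seq (R * seq 'I_m)) b :
  form_coef a (scale_form c T) b = c * form_coef a T b.
Proof. by rewrite /form_coef big_map mulr_sumr; apply: eq_bigr => t _; rewrite mulrA. Qed.

Lemma eq_mulA_pow n m (a : 'I_m -> 'rV[int]_n) N f g :
  f =1 g -> mulA_pow a N f =1 mulA_pow a N g.
Proof. by move=> fg b; rewrite !mulA_powE; apply: eq_sum_words => u _. Qed.

Lemma mulA_pow0 n m (a : 'I_m -> 'rV[int]_n) N f :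
  (forall b, f b = 0) -> forall b, mulA_pow a N f b = 0.
Proof.
by move=> f0; elim: N => [|N IHN] b; [exact: f0 | apply: big1 => i _; exact: IHN].
Qed.

(* The squared i-th binomial generator y^w - y^w' of the toric ideal, in an enumeration
   of all pairs of words. *)
Definition toric_square n m (a : 'I_m -> 'rV[int]_n) (i : nat) : seq (R * seq 'I_m) :=
  if unpickle i is Some (w, w') then
    if (size w == size w') && (wt a w == wt a w') then
      [:: (1, w ++ w); (- 2%:R, w ++ w'); (1, w' ++ w')]
    else [::]
  else [::].

Lemma toric_square_homogeneous n m (a : 'I_m -> 'rV[int]_n) i :
  exists d, homogeneous d (toric_square a i).
Proof.
rewrite /toric_square; case: unpickle => [[w w']|]; last by exists 0%nat.
case: ifP => [/andP[/eqP sw _]|_]; last by exists 0%nat.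
by exists (size w + size w)%nat; rewrite /= !size_cat sw eqxx.
Qed.

(** All three words have the same weight, so 1, -2 and 1 cancel. *)
Lemma toric_square_coef n m (a : 'I_m -> 'rV[int]_n) i b :
  form_coef a (toric_square a i) b = 0.
Proof.
rewrite /toric_square /form_coef; case: unpickle => [[w w']|]; last by rewrite big_nil.
case: ifP => [/andP[_ /eqP ww']|_]; last by rewrite big_nil.
by rewrite !big_cons big_nil /= !wt_cat ww'; ring.
Qed.

Lemma toric_square_ge0 n m (a : 'I_m -> 'rV[int]_n) i x :
  0 <= form_eval (toric_square a i) x.
Proof.
rewrite /toric_square /form_eval; case: unpickle => [[w w']|]; last by rewrite big_nil.
case: ifP => _; last by rewrite big_nil.
rewrite !big_cons big_nil /= !mon_cat.
set A := mon x w; set B := mon x w'.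
have -> : 1 * (A * A) + (- 2%:R * (A * B) + (1 * (B * B) + 0)) = (A - B) ^+ 2 by ring.
exact: sqr_ge0.
Qed.

Lemma toric_square_binomial n m (a : 'I_m -> 'rV[int]_n) x :
  (forall i, form_eval (toric_square a i) x = 0) -> binomial a x.
Proof.
move=> G0 w w' sw ww'; have := G0 (pickle (w, w')).
rewrite /toric_square pickleK sw ww' !eqxx /form_eval /= !big_cons big_nil /= !mon_cat.
set A := mon x w; set B := mon x w'.
have -> : 1 * (A * A) + (- 2%:R * (A * B) + (1 * (B * B) + 0)) = (A - B) ^+ 2 by ring.
by move=> /eqP; rewrite sqrf_eq0 subr_eq0 => /eqP.
Qed.

(** The squares have different degrees, so they are added one at a time after raising both summands
    to a common degree; they leave no trace among the Laurent coefficients. *)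
Lemma penalized_form n m (a : 'I_m -> 'rV[int]_n) k T f c D :
  homogeneous k T -> (form_coef a T =1 f) ->
  exists e T', [/\ homogeneous (k + e) T',
    forall x, in_simplex x -> form_eval T' x =
      form_eval T x + c * \sum_(i < D) form_eval (toric_square a i) x &
    form_coef a T' =1 mulA_pow a e f].
Proof.
move=> hT Tf; elim: D => [|D [e [T' [hT' evT' coT']]]].
  exists 0%nat, T; rewrite addn0; split=> // x _.
  by rewrite big_ord0 mulr0 addr0.
have [g hG] := toric_square_homogeneous a D.
have [h1 ev1 co1] := iter_mul_form a g hT'.
have [h2 ev2 co2] := iter_mul_form a (k + e) hG.
(* Each of the two forms is raised by the degree of the other. *)
exists (e + g)%nat, (iter g (@mul_form R m) T' ++
  scale_form c (iter (k + e) (@mul_form R m) (toric_square a D))); split=> [|x xS|b].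
- rewrite /homogeneous all_cat addnA; apply/andP; split; first exact: h1.
  by rewrite all_map addnC; apply: sub_all h2.
- rewrite {1}/form_eval big_cat -/(form_eval _ _) -/(form_eval _ _) /=.
  rewrite form_eval_scale ev1 // ev2 // evT' // big_ord_recr /=; ring.
- rewrite {1}/form_coef big_cat -/(form_coef _ _ _) -/(form_coef _ _ _) /=.
  rewrite form_coef_scale co2 mulA_pow0 ?mulr0 ?addr0; last exact: toric_square_coef.
  by rewrite co1 (eq_mulA_pow _ _ coT') addnC /mulA_pow iterD.
Qed.

(** * The equivalences *)

Lemma copositive_polya n m (a : 'I_m -> 'rV[int]_n) k f : (0 < m)%nat ->
  supported_in a k f -> strictly_A_copositive a k f ->
  exists M, forall b, in_kA a (k + M) b -> 0 < mulA_pow a M f b.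
Proof.
move=> m0 fS cop; have [w wP] := exists_kA_section a k m0.
pose T := hat_form a f w.
have [||D DP] := @Compactness.penalty_lower_bound _ m T (toric_square a).
- by move=> i x _; exact: toric_square_ge0.
- move=> x [x0 x1] G0; rewrite form_eval_hat; apply: cop => //.
    apply/existsP; apply: contraT; rewrite negb_exists => /forallP xz.
    move: x1; rewrite big1 => [/eqP|i _]; first by rewrite eq_sym oner_eq0.
    by have := xz i; rewrite negbK => /eqP.
  by apply/binomial_in_Y/binomial_complex/toric_square_binomial.
have coT : form_coef a T =1 f by move=> b; apply: form_coef_hat.
have [e [T' [hT' evT' coT']]] := penalized_form D%:R D (homogeneous_hat a f w) coT.
have [||M MP] := @polya n m a (k + e)%nat T' (D.+1%:R^-1) hT'.
- by rewrite invr_gt0 ltr0n.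
- by move=> x xS; rewrite evT' //; exact: DP.
(* The penalized form already carries e factors; Polya's theorem adds M more. *)
exists (M + e)%nat => b; have -> : (k + (M + e) = k + e + M)%nat by lia.
by move=> /MP; rewrite (eq_mulA_pow a M coT') /mulA_pow -iterD.
Qed.

(** Where the binomial equations hold, a monomial depends only on degree and weight, so the chosen
    words [w'] may be exchanged for those of the expanded product. *)
Lemma sum_words_hat n m (a : 'I_m -> 'rV[int]_n) k N f y
    (w : 'rV[int]_n -> k.-tuple 'I_m) (w' : 'rV[int]_n -> (k + N).-tuple 'I_m) :
  supported_in a k f -> binomial a y ->
  (forall b, in_kA a k b -> sumA a (w b) = b) ->
  (forall b, in_kA a (k + N) b -> sumA a (w' b) = b) ->
  \sum_(b <- kA a (k + N)) mulA_pow a N f b * mon y (w' b) =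
  fhat a f w y * (\sum_i y i) ^+ N.
Proof.
move=> fS ybin wP w'P; set T := hat_form a f w.
have coT : form_coef a T =1 f by move=> b; apply: form_coef_hat.
under eq_bigr do rewrite -(eq_mulA_pow a N coT) mulA_pow_form mulr_suml.
rewrite -(sum_words_mon N y) exchange_big -form_eval_hat /form_eval mulr_suml !big_seq /=.
apply: eq_bigr => t /(allP (homogeneous_hat a f w))/eqP tk.
rewrite -[RHS]mulrA -sum_wordsZ.
under eq_bigr do rewrite -mulrA.
rewrite -mulr_sumr; congr (_ * _).
under eq_bigr do rewrite mulrC -sum_wordsZ.
rewrite -sum_words_sum; apply: eq_sum_words => u uN.
have tuk : size (t.2 ++ u) = (k + N)%nat by rewrite size_cat tk uN.
have bk : in_kA a (k + N) (wt a (t.2 ++ u)) by apply/in_kAP; exists (t.2 ++ u).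
under eq_bigr do rewrite eq_sym.
rewrite sum_indicator ?undup_uniq ?mem_kA // -mon_cat.
by apply: ybin; rewrite ?size_tuple // -sumAE w'P.
Qed.

Lemma nonneg_coefs_copositive n m (a : 'I_m -> 'rV[int]_n) k N f :
  injective a -> (0 < m)%nat -> supported_in a k f -> newt_eq_conv_kA a k f ->
  (forall b, 0 <= mulA_pow a N f b) -> strictly_A_copositive a k f.
Proof.
move=> a_inj m0 fS newt Nf y y0 yn0 /in_Y_binomial ybin w wP.
have [v vV yv] := vertex_of_binomial a_inj ybin yn0.
have yv0 : 0 < y v by rewrite lt_def yv y0.
have [w' w'P] := exists_kA_section a (k + N) m0.
have S0 : 0 < (\sum_i y i) ^+ N.
  by rewrite exprn_gt0 // (bigD1 v) //= ltr_pwDl // sumr_ge0.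
rewrite -(pmulr_lgt0 _ S0) -(sum_words_hat fS ybin wP w'P).
pose b0 := a v *+ (k + N); have b0k : b0 \in kA a (k + N) by rewrite mem_kA in_kA_mulrn.
rewrite (bigD1_seq b0) ?undup_uniq //= ltr_pwDl //; last first.
  by apply: sumr_ge0 => b _; rewrite mulr_ge0 // mon_ge0.
rewrite mulr_gt0 //.
  (* The coefficient at the vertex is that of f, nonzero by the Newton polytope condition. *)
  rewrite lt_def Nf andbT /b0 mulA_pow_vertex //; exact: vertex_newt_eq newt vV.
rewrite (ybin _ (nseq (k + N) v)) ?size_tuple ?size_nseq //.
  by rewrite mon_nseq exprn_gt0.
by rewrite wt_nseq -sumAE w'P // in_kA_mulrn.
Qed.

Theorem mainTheorem5 (n m : nat) (a : 'I_m -> 'rV[int]_n)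
    (a_inj : injective a) (m_gt0 : (0 < m)%nat)
    (k : nat) (f : 'rV[int]_n -> R) (f_supp : supported_in a k f) :
  (strictly_A_copositive a k f <->
     newt_eq_conv_kA a k f /\
     exists M : nat, forall b, in_kA a (k + M) b -> 0 < mulA_pow a M f b)
  /\
  (strictly_A_copositive a k f <->
     newt_eq_conv_kA a k f /\
     exists N : nat, forall b, 0 <= mulA_pow a N f b).
Proof.
have i_ii : strictly_A_copositive a k f -> newt_eq_conv_kA a k f /\
     exists M : nat, forall b, in_kA a (k + M) b -> 0 < mulA_pow a M f b.
  move=> cop; split; last exact: copositive_polya.
  apply: newt_eq_of_vertices => // v vV.
  by rewrite gt_eqF //; exact: copositive_vertex_gt0 cop vV.
have ii_iii M : (forall b, in_kA a (k + M) b -> 0 < mulA_pow a M f b) ->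
    forall b, 0 <= mulA_pow a M f b.
  move=> pos b; have [/pos/ltW //|bk] := boolP (in_kA a (k + M) b).
  suff -> : mulA_pow a M f b = 0 by [].
  by apply/eqP; apply: contraNT bk; apply: supported_mulA_pow.
split; split.
- exact: i_ii.
- by move=> [newt [M /ii_iii Mf]]; exact: nonneg_coefs_copositive newt Mf.
- by move=> /i_ii[newt [M /ii_iii Mf]]; split=> //; exists M.
- by move=> [newt [N Nf]]; exact: nonneg_coefs_copositive newt Nf.
Qed.
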